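(* Let $v$ be a vtree over variables $\mathbf{X}=\{X_1,\ldots,X_M\}$ whose nodes carry preorder IDs. Let $u,w$ be nodes of $v$ such that the subtrees rooted at $u$ and at $w$ are isomorphic (as ordered binary trees), and let $\delta=\mathtt{ID}(w)-\mathtt{ID}(u)$, which equals the difference of IDs of any pair of corresponding nodes of the two subtrees. Let $\pi_{u,w}:\{1,\ldots,M\}\to\{1,\ldots,M\}$ be a bijection such that $\pi_{u,w}(j)=i$ whenever $X_i$ is the variable of a leaf $u'$ of the subtree at $u$ and $X_j$ is the variable of the leaf $w'$ of the subtree at $w$ corresponding to $u'$ under the isomorphism. Let $f,g$ be Boolean functions over $\mathbf{X}$ such that $f$ essentially depends on vtree node $u$, $g$ essentially depends on vtree node $w$, and $f,g$ are substitution-equivalent with $\pi_{u,w}$. Then the compressed and trimmed VS-SDDs $(\alpha,k)$ and $(\beta,\ell)$ (with respect to $v$) representing $f$ and $g$ respectively satisfy $\alpha=\beta$ and $\ell=k+\delta$.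
   Context: A vtree over a set of variables is an ordered full binary tree whose leaves are in one-to-one correspondence with the variables; $l(x)$ denotes the variable of leaf $x$. Each vtree node $x$ is assigned an integer ID $\mathtt{ID}(x)$ following a preorder traversal; $\mathtt{ID}^{-1}(i)$ is the node with ID $i$. A node $y$ is a left (resp. right) descendant of $x$ if $y$ is a (not necessarily proper) descendant of the left (resp. right) child of $x$. For disjoint variable sets $\mathbf{X},\mathbf{Y}$, an $\mathbf{X}$-partition of $f(\mathbf{X},\mathbf{Y})$ is an expression $f=\bigvee_{i=1}^n[p_i(\mathbf{X})\wedge s_i(\mathbf{Y})]$ with $p_i\wedge p_j=\mathit{false}$ for $i\ne j$, $\bigvee_i p_i=\mathit{true}$, and $p_i\ne\mathit{false}$ for all $i$; it is compressed if $s_i\neq s_j$ for $i\ne j$. A VS-SDD is a pair $(\alpha,k)$ of a structure $\alpha$ (a node of a DAG) and an integer offset $k$, with semantics $\langle\alpha,k\rangle$ defined recursively: (constant) $\alpha=\top$ or $\bot$, with $\langle\top,\cdot\rangle=\mathit{true}$, $\langle\bot,\cdot\rangle=\mathit{false}$; (literal) $\alpha=\mathbf{v}$ or $\neg\mathbf{v}$ where $\mathtt{ID}^{-1}(k)$ is a leaf, with $\langle\mathbf{v},k\rangle=l(\mathtt{ID}^{-1}(k))$ and $\langle\neg\mathbf{v},k\rangle=\neg l(\mathtt{ID}^{-1}(k))$; (decomposition) $\alpha=\{([p_1,d_1],[s_1,e_1]),\ldots,([p_n,d_n],[s_n,e_n])\}$ where $\mathtt{ID}^{-1}(k)$ is internal,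 each $p_i,s_i$ is a structure, $d_i,e_i$ are integers with $\mathtt{ID}^{-1}(d_i+k)$ a left descendant and $\mathtt{ID}^{-1}(e_i+k)$ a right descendant of $\mathtt{ID}^{-1}(k)$, and $\langle p_1,d_1+k\rangle,\ldots,\langle p_n,d_n+k\rangle$ form a partition; $\langle\alpha,k\rangle=\bigvee_i(\langle p_i,d_i+k\rangle\wedge\langle s_i,e_i+k\rangle)$. Identical structures are shared only when their offsets correspond to vtree nodes with isomorphic subtrees. A VS-SDD is compressed if every decomposition $(\beta,\ell)$ appearing in it forms a compressed partition; it is trimmed if it contains no decomposition of the form $\{([\top,\cdot],[\beta,d])\}$ or $\{([\beta,d],[\top,\cdot]),([\neg\beta,d],[\bot,\cdot])\}$. A Boolean function $f$ essentially depends on variable $X$ if $f|X\ne f|\neg X$; $f$ essentially depends on vtree node $x$ if $f$ is non-trivial (not constantly true/false) and $x$ is the deepest vtree node whose leaves include all variables $f$ essentially depends on. Two Boolean functions $f,g$ over $X_1,\ldots,X_M$ are substitution-equivalent with a bijection $\pi$ of $\{1,\ldots,M\}$ if $f(X_1=x_1,\ldots,X_M=x_M)=g(X_1=x_{\pi(1)},\ldots,X_M=x_{\pi(M)})$ for every assignment. *)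

(* Defs.v *)
From Stdlib Require List.
From HB Require Import structures.
From mathcomp Require Import all_boot all_order all_fingroup all_algebra.
Set Implicit Arguments.
Unset Strict Implicit.
Unset Printing Implicit Defensive.
Local Open Scope ring_scope.

Inductive tree (T : Type) : Type := Leaf of T | Node of tree T & tree T.
Arguments Leaf {T} _.
Arguments Node {T} _ _.

Fixpoint tree_encode T (x : tree T) : GenTree.tree T :=
  match x with
  | Leaf i => GenTree.Leaf i
  | Node l r => GenTree.Node 0 [:: tree_encode l; tree_encode r]
  end.

Fixpoint tree_decode T (x : GenTree.tree T) : option (tree T) :=
  match x with
  | GenTree.Leaf i => Some (Leaf i)
  | GenTree.Node _ [:: l; r] =>
      if (tree_decode l, tree_decode r) is (Some l', Some r')
      then Some (Node l' r') else None
  | _ => None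
  end.

Lemma tree_encodeK T : pcancel (@tree_encode T) (@tree_decode T).
Proof. by elim=> [|l /= -> r ->]. Qed.

HB.instance Definition _ (T : eqType) :=
  Equality.copy (tree T) (pcan_type (@tree_encodeK T)).

(* All subtrees of x, x included, in preorder.  In a vtree the leaf labels are
   pairwise distinct, so distinct nodes root distinct subtrees; a node is
   therefore represented by the subtree it roots, and [nodes x] is also the
   list of (not necessarily proper) descendants of x. *)
Fixpoint nodes T (x : tree T) : seq (tree T) :=
  x :: match x with
       | Leaf _ => [::]
       | Node l r => nodes l ++ nodes r
       end.

Fixpoint leaves T (x : tree T) : seq T :=
  match x with
  | Leaf i => [:: i]
  | Node l r => leaves l ++ leaves r
  end.

Fixpoint tree_shape T (x : tree T) : tree unit :=
  match x with
  | Leaf _ => Leaf tt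
  | Node l r => Node (tree_shape l) (tree_shape r)
  end.

Definition isomorphic T (x y : tree T) : Prop := tree_shape x = tree_shape y.

(* The pairs (x', y') of nodes of x and y that correspond to each other under
   the unique isomorphism of ordered trees, when x and y are isomorphic. *)
Fixpoint corresponding T (x y : tree T) : seq (tree T * tree T) :=
  (x, y) :: match x, y with
            | Node l r, Node l' r' => corresponding l l' ++ corresponding r r'
            | _, _ => [::]
            end.

(* The variables X_1, ..., X_M are indexed by 'I_M. *)
Definition is_vtree M (v : tree 'I_M) : Prop :=
  uniq (leaves v) /\ forall i : 'I_M, i \in leaves v.

(* Preorder IDs; the root has ID 0. *)
Definition ID M (v x : tree 'I_M) : int := (index x (nodes v))%:Z.

Definition ID_inv M (v : tree 'I_M) (k : int) : option (tree 'I_M) :=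
  if k is Posz n then onth (nodes v) n else None.

(* The number of proper ancestors of x in v. *)
Definition depth M (v x : tree 'I_M) : nat :=
  count [pred y | (y != x) && (x \in nodes y)] (nodes v).

Definition assignment (M : nat) := {ffun 'I_M -> bool}.
Definition boolfun (M : nat) := {ffun assignment M -> bool}.

Definition bconst M (b : bool) : boolfun M := [ffun => b].

Definition condition M (f : boolfun M) (i : 'I_M) (b : bool) : boolfun M :=
  [ffun a : assignment M => f [ffun j => if j == i then b else a j]].

Definition depends_on_var M (f : boolfun M) (i : 'I_M) : Prop :=
  condition f i true <> condition f i false.

Definition covers M (f : boolfun M) (x : tree 'I_M) : Prop :=
  forall i, depends_on_var f i -> i \in leaves x.

Definition depends_on_node M (v : tree 'I_M) (f : boolfun M) (x : tree 'I_M)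
    : Prop :=
  [/\ forall b, f <> bconst M b,
      x \in nodes v,
      covers f x
    & forall y, y \in nodes v -> covers f y -> (depth v y <= depth v x)%N].

Definition substitution_equivalent M (s : 'S_M) (f g : boolfun M) : Prop :=
  forall a : assignment M, f a = g [ffun i => a (s i)].

(* The list in [Dec t l] enumerates the set {([p_i,d_i],[s_i,e_i])}.  The tag t
   is the shape of the vtree subtree at which the decomposition is used.  It is
   determined by the offset, and it makes structures equal only if they are
   used at vtree nodes with isomorphic subtrees, which is the condition under
   which identical structures may be shared. *)
Inductive structure : Type :=
  | Top
  | Bot
  | Pos
  | Neg
  | Dec of tree unit & seq ((structure * int) * (structure * int)).

Definition is_const (a : structure) : bool :=
  match a with Top | Bot => true | _ => false end.

(* Equality of structures: decompositions are compared as sets, and the offset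
   attached to a constant, being irrelevant, is ignored. *)
Fixpoint same_structure (a b : structure) : bool :=
  let same_elem x y :=
    let: ((p, d), (s, e)) := x in
    let: ((p', d'), (s', e')) := y in
    [&& same_structure p p', is_const p || (d == d'),
        same_structure s s' & is_const s || (e == e')] in
  match a, b with
  | Top, Top | Bot, Bot | Pos, Pos | Neg, Neg => true
  | Dec t l, Dec t' l' =>
      [&& t == t',
          all (fun x => has (fun y => same_elem x y) l') l
        & all (fun y => has (fun x => same_elem x y) l) l']
  | _, _ => false
  end.

Fixpoint negate (a : structure) : structure :=
  match a with
  | Top => Bot
  | Bot => Top
  | Pos => Neg
  | Neg => Pos
  | Dec t l =>
      Dec t [seq let: (p, (s, e)) := x in (p, (negate s, e)) | x <- l]
  end.

(* The value of <a, k> at an assignment; the value false for a literal whose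
   offset is not the ID of a leaf is a dummy, excluded by [vssdd]. *)
Fixpoint eval M (v : tree 'I_M) (a : structure) (k : int) (x : assignment M)
    : bool :=
  match a with
  | Top => true
  | Bot => false
  | Pos => if ID_inv v k is Some (Leaf i) then x i else false
  | Neg => if ID_inv v k is Some (Leaf i) then ~~ x i else false
  | Dec _ l =>
      has (fun y => let: ((p, d), (s, e)) := y in
             eval v p (d + k) x && eval v s (e + k) x) l
  end.

Definition sem M (v : tree 'I_M) (a : structure) (k : int) : boolfun M :=
  [ffun x => eval v a k x].

Definition prime_sems M (v : tree 'I_M) (k : int)
    (l : seq ((structure * int) * (structure * int))) : seq (boolfun M) :=
  [seq sem v x.1.1 (x.1.2 + k) | x <- l].

Definition sub_sems M (v : tree 'I_M) (k : int)
    (l : seq ((structure * int) * (structure * int))) : seq (boolfun M) :=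
  [seq sem v x.2.1 (x.2.2 + k) | x <- l].

Definition is_partition M (ps : seq (boolfun M)) : Prop :=
  [/\ forall i j, (i < size ps)%N -> (j < size ps)%N -> i <> j ->
        forall x, nth (bconst M false) ps i x && nth (bconst M false) ps j x
                  = false,
      forall x, has (fun p : boolfun M => p x) ps
    & bconst M false \notin ps].

(* The offset of a constant is arbitrary. *)
Definition placed_below M (v : tree 'I_M) (a : structure) (k : int)
    (y : tree 'I_M) : Prop :=
  is_const a \/ exists2 z, ID_inv v k = Some z & z \in nodes y.

Inductive vssdd M (v : tree 'I_M) : structure -> int -> Prop :=
  | vssdd_top k : vssdd v Top k
  | vssdd_bot k : vssdd v Bot k
  | vssdd_pos k i : ID_inv v k = Some (Leaf i) -> vssdd v Pos k
  | vssdd_neg k i : ID_inv v k = Some (Leaf i) -> vssdd v Neg k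
  | vssdd_dec t l k xl xr :
      ID_inv v k = Some (Node xl xr) ->
      t = tree_shape (Node xl xr) ->
      (forall p d s e, List.In ((p, d), (s, e)) l -> vssdd v p (d + k)) ->
      (forall p d s e, List.In ((p, d), (s, e)) l -> vssdd v s (e + k)) ->
      (forall p d s e, List.In ((p, d), (s, e)) l ->
         placed_below v p (d + k) xl) ->
      (forall p d s e, List.In ((p, d), (s, e)) l ->
         placed_below v s (e + k) xr) ->
      is_partition (prime_sems v k l) ->
      vssdd v (Dec t l) k.

(* [appears b j a k]: (b, j) appears in (a, k). *)
Inductive appears (b : structure) (j : int) : structure -> int -> Prop :=
  | appears_refl : appears b j b j
  | appears_prime t l k p d s e :
      List.In ((p, d), (s, e)) l -> appears b j p (d + k) ->
      appears b j (Dec t l) k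
  | appears_sub t l k p d s e :
      List.In ((p, d), (s, e)) l -> appears b j s (e + k) ->
      appears b j (Dec t l) k.

Definition compressed M (v : tree 'I_M) (a : structure) (k : int) : Prop :=
  forall t l j, appears (Dec t l) j a k -> uniq (sub_sems v j l).

(* The offsets 0 of the constants below are placeholders, ignored by
   [same_structure]. *)
Definition trimmable (a : structure) : Prop :=
  exists t b d,
    same_structure a (Dec t [:: ((Top, 0), (b, d))]) \/
    same_structure a
      (Dec t [:: ((b, d), (Top, 0)); ((negate b, d), (Bot, 0))]).

Definition trimmed (a : structure) (k : int) : Prop :=
  forall b j, appears b j a k -> ~ trimmable b.

(* Main.v *)
Require Import Defs.
From mathcomp Require Import all_boot all_order all_fingroup all_algebra.
Set Implicit Arguments.
Unset Strict Implicit.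
Unset Printing Implicit Defensive.
Import GRing.Theory.
Local Open Scope ring_scope.

(** A compressed and trimmed decomposition at an internal node essentially
    depends on both children: if it did not depend on the left one all its subs
    would coincide, and if it did not depend on the right one all its subs would
    be constant, so by compression it would have one of the two forms excluded
    by trimming.  Hence the offset of a nonconstant VS-SDD can be read off the
    essential variables of its function, and substitution-equivalent functions
    are decomposed at corresponding nodes.  A compressed partition is moreover
    determined by its function: the subs are its cofactors, and each prime
    collects the assignments with the same cofactor.  So the elements of the two
    decompositions match up to the renaming, and one recurses into the children.
    Recognizing the second form excluded by trimming requires canonicity at the
    children, so both facts are proved by a simultaneous induction on the shape
    of the vtree. *)

(** * Lists over types without decidable equality *)

Lemma In_hasP T (P : pred T) (s : seq T) :
  reflect (exists2 x, List.In x s & P x) (has P s).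
Proof.
elim: s => [|y s IHs] /=; first by constructor; case.
apply: (iffP orP) => [[Py|/IHs[x xs Px]]|[x [->|xs] Px]].
- by exists y => //; left.
- by exists x => //; right.
- by left.
- by right; apply/IHs; exists x.
Qed.

Lemma In_allP T (P : pred T) (s : seq T) :
  reflect (forall x, List.In x s -> P x) (all P s).
Proof.
elim: s => [|y s IHs] /=; first by constructor.
apply: (iffP andP) => [[Py /IHs Ps] x [<-|/Ps]|Ps] //.
by split; [apply: Ps; left | apply/IHs => x xs; apply: Ps; right].
Qed.

Lemma In_nthP T (x0 x : T) (s : seq T) :
  List.In x s -> exists2 i, (i < size s)%N & nth x0 s i = x.
Proof.
elim: s => [|y s IHs] //= [->|/IHs[i lt_i <-]]; first by exists 0%N.
by exists i.+1.
Qed.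

Lemma uniq_map_In_inj T (U : eqType) (h : T -> U) (s : seq T) x y :
  uniq (map h s) -> List.In x s -> List.In y s -> h x = h y -> x = y.
Proof.
move=> us /(In_nthP x)[i lt_i xE] /(In_nthP x)[j lt_j yE] hxy.
suff ij : i = j by rewrite -xE -yE ij.
apply/eqP; rewrite -(nth_uniq (h x) _ _ us) ?size_map //.
by rewrite !(nth_map x) // xE yE hxy.
Qed.

(** * Nodes and leaves of a vtree *)

Lemma nodes_cons T (x : tree T) : nodes x = x :: behead (nodes x).
Proof. by case: x. Qed.

Lemma nodes_self (T : eqType) (x : tree T) : x \in nodes x.
Proof. by rewrite nodes_cons mem_head. Qed.

Lemma leaves_neq0 (T : eqType) (x : tree T) : exists i, i \in leaves x.
Proof.
elim: x => [i|l [i il] r _]; first by exists i; rewrite inE.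
by exists i; rewrite /= mem_cat il.
Qed.

Lemma leaves_nodes (T : eqType) (x y : tree T) :
  y \in nodes x -> {subset leaves y <= leaves x}.
Proof.
elim: x => [i|l IHl r IHr] /=; first by rewrite inE => /eqP->.
rewrite inE mem_cat => /or3P[/eqP->//|/IHl|/IHr] sub i /sub;
  by rewrite mem_cat => ->; rewrite ?orbT.
Qed.

Lemma nodes_trans (T : eqType) (x y z : tree T) :
  y \in nodes x -> z \in nodes y -> z \in nodes x.
Proof.
elim: x => [i|l IHl r IHr] /=; first by rewrite inE => /eqP->.
rewrite !inE !mem_cat => /or3P[/eqP->|/IHl yz /yz->|/IHr yz /yz->];
  by rewrite ?orbT //= inE mem_cat.
Qed.

Lemma nodes_child (T : eqType) (x l r : tree T) :
  Node l r \in nodes x -> l \in nodes x /\ r \in nodes x.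
Proof.
by move=> nx; split; apply: nodes_trans nx _;
  rewrite inE mem_cat nodes_self ?orbT.
Qed.

Lemma size_leaves_gt0 T (x : tree T) : (0 < size (leaves x))%N.
Proof. by elim: x => //= l IHl r IHr; rewrite size_cat addn_gt0 IHl. Qed.

Lemma size_leaves_nodes (T : eqType) (x y : tree T) :
  y \in nodes x -> (size (leaves y) <= size (leaves x))%N.
Proof.
elim: x => [i|l IHl r IHr] /=; first by rewrite inE => /eqP->.
rewrite inE mem_cat size_cat => /or3P[/eqP->|/IHl|/IHr] /=.
- by rewrite size_cat.
- by move/leq_trans; apply; apply: leq_addr.
- by move/leq_trans; apply; apply: leq_addl.
Qed.

Lemma uniq_leaves_nodes (T : eqType) (x y : tree T) :
  uniq (leaves x) -> y \in nodes x -> uniq (leaves y).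
Proof.
elim: x => [i|l IHl r IHr] /=; first by rewrite inE => _ /eqP->.
rewrite cat_uniq => /and3P[ul dlr ur].
rewrite inE mem_cat => /or3P[/eqP->|/IHl->|/IHr->] //=.
by rewrite cat_uniq ul dlr.
Qed.

Lemma disjoint_children (T : eqType) (l r : tree T) i :
  uniq (leaves (Node l r)) -> i \in leaves l -> i \in leaves r -> False.
Proof.
by rewrite /= cat_uniq => /and3P[_ /hasPn dlr _] il /dlr; rewrite /= il.
Qed.

(** A node has more leaves than either child, so it does not recur below itself, and a node common
    to both children would make them share a leaf. *)
Lemma uniq_nodes (T : eqType) (x : tree T) : uniq (leaves x) -> uniq (nodes x).
Proof.
elim: x => [i|l IHl r IHr] //= ulr.
have := ulr; rewrite cat_uniq => /and3P[ul _ ur].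
rewrite mem_cat cat_uniq IHl // IHr // andbT; apply/andP; split.
  apply/norP; split; apply/negP => /size_leaves_nodes /=; rewrite size_cat.
    by rewrite -[leqRHS]addn0 leq_add2l leqNgt size_leaves_gt0.
  by rewrite -[leqRHS]add0n leq_add2r leqNgt size_leaves_gt0.
apply/hasPn => y yr; apply/negP => yl.
have [i iy] := leaves_neq0 y.
exact: disjoint_children ulr (leaves_nodes yl iy) (leaves_nodes yr iy).
Qed.

Lemma nodes_comparable (T : eqType) (v x y : tree T) i :
  uniq (leaves v) -> x \in nodes v -> y \in nodes v ->
  i \in leaves x -> i \in leaves y -> x \in nodes y \/ y \in nodes x.
Proof.
move=> uv xv yv ix iy; elim: v uv xv yv => [j|l IHl r IHr] uv.
  by rewrite !inE => /eqP-> /eqP->; left; apply: nodes_self.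
have := uv; rewrite /= cat_uniq => /and3P[ul _ ur].
rewrite [x \in _]inE [y \in _]inE !mem_cat.
case/predU1P=> [->|xlr]; first by right; rewrite inE mem_cat.
case/predU1P=> [->|]; first by left; rewrite /= inE mem_cat xlr orbT.
case/orP: xlr => [xl|xr] /orP[yl|yr].
- exact: IHl.
- by case: (disjoint_children uv (leaves_nodes xl ix) (leaves_nodes yr iy)).
- by case: (disjoint_children uv (leaves_nodes yl iy) (leaves_nodes xr ix)).
- exact: IHr.
Qed.

(** * Preorder IDs *)

Lemma nodes_infix (T : eqType) (v x : tree T) :
  x \in nodes v -> exists s1 s2, nodes v = s1 ++ nodes x ++ s2.
Proof.
elim: v => [i|l IHl r IHr] /=.
  by rewrite inE => /eqP->; exists [::], [::].
rewrite inE mem_cat => /or3P[/eqP->|/IHl[s1 [s2 E]]|/IHr[s1 [s2 E]]].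
- by exists [::], [::]; rewrite cats0.
- by exists (Node l r :: s1), (s2 ++ nodes r); rewrite E /= -!catA.
- by exists (Node l r :: nodes l ++ s1), s2; rewrite E /= -!catA.
Qed.

Lemma index_nodes_infix (T : eqType) (x : tree T) s1 s2 :
  uniq (s1 ++ nodes x ++ s2) -> index x (s1 ++ nodes x ++ s2) = size s1.
Proof.
rewrite nodes_cons /= cat_uniq => /and3P[_ /hasPn/(_ x (mem_head _ _))/= xs1 _].
by rewrite index_cat (negbTE xs1) /= eqxx addn0.
Qed.

(** A subtree fills a contiguous block of the preorder that starts with its root. The left block
    follows the parent at once, and the right block follows the left one. *)
Lemma ID_children M (v l r : tree 'I_M) :
  uniq (leaves v) -> Node l r \in nodes v ->
  ID v l = ID v (Node l r) + 1 /\
  ID v r = ID v (Node l r) + 1 + (size (nodes l))%:Z.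
Proof.
move=> /uniq_nodes uv /nodes_infix[s1 [s2 E]]; rewrite /ID.
have E1 : nodes v = rcons s1 (Node l r) ++ nodes l ++ (nodes r ++ s2).
  by rewrite E /= cat_rcons -catA.
have E2 : nodes v = (rcons s1 (Node l r) ++ nodes l) ++ nodes r ++ s2.
  by rewrite E1 -catA.
have i0 : index (Node l r) (nodes v) = size s1.
  by rewrite E index_nodes_infix -?E.
have -> : index l (nodes v) = (size s1).+1.
  by rewrite E1 index_nodes_infix -?E1 // size_rcons.
have -> : index r (nodes v) = ((size s1).+1 + size (nodes l))%N.
  by rewrite E2 index_nodes_infix -?E2 // size_cat size_rcons.
by rewrite i0 PoszD -addn1 PoszD.
Qed.

Lemma size_nodes_shape T (x y : tree T) :
  tree_shape x = tree_shape y -> size (nodes x) = size (nodes y).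
Proof.
elim: x y => [i|l IHl r IHr] [j|l' r'] //= [/IHl E /IHr E'].
by rewrite !size_cat E E'.
Qed.

Lemma ID_inv_nodes M (v x : tree 'I_M) k : ID_inv v k = Some x -> x \in nodes v.
Proof. by case: k => // n /= E; apply/onthP; exists n. Qed.

Lemma ID_invK M (v x : tree 'I_M) k :
  uniq (leaves v) -> ID_inv v k = Some x -> k = ID v x.
Proof.
case: k => // n /uniq_nodes uv /= E.
have lt_n : (n < size (nodes v))%N by rewrite -onthTE E.
by rewrite /ID -(onth_nth x x _ _ E) index_uniq.
Qed.

(** * Corresponding nodes *)

Lemma corresponding_refl (T : eqType) (x y z : tree T) :
  (y, z) \in corresponding x x -> y = z.
Proof.
elim: x => [i|l IHl r IHr] /=; first by rewrite inE => /eqP[-> ->].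
by rewrite inE mem_cat => /or3P[/eqP[-> ->]|/IHl|/IHr].
Qed.

Lemma corresponding_leafr (T : eqType) (x y : tree T) j :
  tree_shape x = tree_shape y -> j \in leaves y ->
  exists2 i, i \in leaves x & (Leaf i, Leaf j) \in corresponding x y.
Proof.
elim: x y => [i|l IHl r IHr] [j'|l' r'] //=.
  by move=> _; rewrite inE => /eqP->; exists i; rewrite inE.
case=> sl sr; rewrite mem_cat => /orP[/(IHl _ sl)|/(IHr _ sr)] [i il ic];
  by exists i; rewrite ?inE mem_cat ?il ?ic ?orbT.
Qed.

Lemma corresponding_leafl (T : eqType) (x y : tree T) i :
  tree_shape x = tree_shape y -> i \in leaves x ->
  exists2 j, j \in leaves y & (Leaf i, Leaf j) \in corresponding x y.
Proof.
elim: x y => [i'|l IHl r IHr] [j|l' r'] //=.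
  by move=> _; rewrite inE => /eqP->; exists j; rewrite inE.
case=> sl sr; rewrite mem_cat => /orP[/(IHl _ sl)|/(IHr _ sr)] [j jl jc];
  by exists j; rewrite ?inE mem_cat ?jl ?jc ?orbT.
Qed.

(** The hypothesis on [s] in the theorem, stated for arbitrary subtrees so that it passes to their
    children. *)
Definition renames M (s : 'S_M) (x y : tree 'I_M) : Prop :=
  forall i j, (Leaf i, Leaf j) \in corresponding x y -> s j = i.

Lemma renames_children M (s : 'S_M) (xl xr yl yr : tree 'I_M) :
  renames s (Node xl xr) (Node yl yr) -> renames s xl yl /\ renames s xr yr.
Proof.
by move=> sxy; split=> i j ij; apply: sxy; rewrite /= inE mem_cat ij ?orbT.
Qed.

Lemma renames_leaves M (s : 'S_M) (x y : tree 'I_M) i :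
  tree_shape x = tree_shape y -> renames s x y ->
  (s i \in leaves x) = (i \in leaves y).
Proof.
move=> sh sxy; apply/idP/idP => [/(corresponding_leafl sh)[j jy /sxy]|].
  by move/perm_inj <-.
by case/(corresponding_leafr sh)=> j jx /sxy->.
Qed.

(** * Supports of Boolean functions *)

(** Independence from all variables outside [A] at once; with [A] empty it says that [F] is
    constant. *)
Definition supported M (F : assignment M -> bool) (A : seq 'I_M) : Prop :=
  forall a a' : assignment M, {in A, a =1 a'} -> F a = F a'.

Definition mix M (A : seq 'I_M) (a c : assignment M) : assignment M :=
  [ffun i => if i \in A then a i else c i].

Definition pullback M (s : 'S_M) (a : assignment M) : assignment M :=
  [ffun i => a (s i)].

Lemma pullbackK M (s : 'S_M) (a : assignment M) :
  pullback s (pullback s^-1 a) = a.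
Proof. by apply/ffunP => i; rewrite !ffunE permK. Qed.

Lemma supported_sub M (F : assignment M -> bool) (A B : seq 'I_M) :
  {subset A <= B} -> supported F A -> supported F B.
Proof. by move=> sAB FA a a' aB; apply: FA => i /sAB/aB. Qed.

(** Any [a] and [a'] are linked by the assignment that follows [a] on [A] and [a'] elsewhere: each
    support allows one of the two moves. *)
Lemma supported_disjoint M (F : assignment M -> bool) (A B : seq 'I_M) :
  (forall i, i \in A -> i \in B -> False) ->
  supported F A -> supported F B -> supported F [::].
Proof.
move=> dAB FA FB a a' _; rewrite (FA a (mix A a a')) => [|i iA]; last first.
  by rewrite ffunE iA.
by apply: FB => i iB; rewrite ffunE; case: ifP => // /dAB/(_ iB).
Qed.

(** [pullback] carries agreement on the leaves of [x] to agreement on those of [y], and back because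
    [s] is a permutation. *)
Lemma supported_pullback M (s : 'S_M) (x y : tree 'I_M) b
    (F G : assignment M -> bool) :
  tree_shape x = tree_shape y -> renames s x y ->
  (forall a, F a = b (+) G (pullback s a)) ->
  supported F (leaves x) <-> supported G (leaves y).
Proof.
move=> sh sxy FG; split=> [Fx c c' cy|Gy a a' ax]; last first.
  by rewrite !FG; congr (_ (+) _); apply: Gy => i iy; rewrite !ffunE ax //
    (renames_leaves _ sh sxy).
apply: (can_inj (addKb b)).
rewrite -(pullbackK s c) -(pullbackK s c') -!FG; apply: Fx => i ix.
by rewrite !ffunE cy // -(renames_leaves _ sh sxy) permKV.
Qed.

Lemma constant_pullback M (s : 'S_M) b (F G : assignment M -> bool) :
  (forall a, F a = b (+) G (pullback s a)) ->
  supported F [::] -> supported G [::].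
Proof.
move=> FG F0 c c' _; apply: (can_inj (addKb b)).
by rewrite -(pullbackK s c) -(pullbackK s c') -!FG; apply: F0.
Qed.

(** Pass from [a] to [a'] one variable at a time: a variable on which [f] depends is a leaf of [x],
    where the two agree, and any other variable can be changed freely. *)
Lemma covers_supported M (f : boolfun M) (x : tree 'I_M) :
  covers f x -> supported f (leaves x).
Proof.
move=> cfx a a' aa'.
suff mixE s : f (mix s a' a) = f a.
  rewrite -(mixE (enum 'I_M)); congr (f _); apply/ffunP => i.
  by rewrite ffunE mem_enum.
elim: s => [|i s <-]; first by congr (f _); apply/ffunP => i; rewrite ffunE.
pose m := mix s a' a.
have setE (c : bool) : f [ffun j => if j == i then c else m j] = condition f i c m.
  by rewrite ffunE.
have -> : mix (i :: s) a' a = [ffun j => if j == i then a' i else m j].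
  by apply/ffunP => j; rewrite !ffunE inE; case: eqP => [->|].
have -> : mix s a' a = [ffun j => if j == i then m i else m j].
  by apply/ffunP => j; rewrite !ffunE; case: eqP => [->|].
rewrite !setE; case: (eqVneq (condition f i true) (condition f i false)) => [E|/eqP d].
  by case: (a' i) (m i) => [] []; rewrite ?E.
by have -> : m i = a' i by rewrite ffunE (aa' i (cfx i d)) if_same.
Qed.

(** * Decompositions *)

Definition element := ((structure * int) * (structure * int))%type.

Definition same_element (x y : element) : bool :=
  [&& same_structure x.1.1 y.1.1, is_const x.1.1 || (x.1.2 == y.1.2),
      same_structure x.2.1 y.2.1 & is_const x.2.1 || (x.2.2 == y.2.2)].

Lemma same_structure_Dec t t' (l l' : seq element) :
  same_structure (Dec t l) (Dec t' l') =
    [&& t == t', all (fun x => has (same_element x) l') l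
      & all (fun y => has (same_element^~ y) l) l'].
Proof.
rewrite /=; congr [&& _, _ & _].
  by apply: eq_all => -[[p d] [s e]]; apply: eq_has => -[[p' d'] [s' e']].
by apply: eq_all => -[[p d] [s e]]; apply: eq_has => -[[p' d'] [s' e']].
Qed.

(** Syntactic counterpart of [b (+)] on functions. *)
Definition xor_structure (b : bool) (a : structure) : structure :=
  if b then negate a else a.

Definition xor_element (b : bool) (q : element) : element :=
  (q.1, (xor_structure b q.2.1, q.2.2)).

Lemma xor_structure_Dec b t (l : seq element) :
  xor_structure b (Dec t l) = Dec t (map (xor_element b) l).
Proof.
case: b => /=; congr (Dec t _).
  by apply: eq_map => -[p [s e]].
by rewrite -[LHS]map_id; apply: eq_map => -[p [s e]].
Qed.

Definition prime_of M (v : tree 'I_M) (k : int) (q : element) : assignment M -> bool :=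
  eval v q.1.1 (q.1.2 + k).

Definition sub_of M (v : tree 'I_M) (k : int) (q : element) : assignment M -> bool :=
  eval v q.2.1 (q.2.2 + k).

Lemma eval_Dec M (v : tree 'I_M) t (l : seq element) k a :
  eval v (Dec t l) k a = has (fun q => prime_of v k q a && sub_of v k q a) l.
Proof. by apply: eq_has => -[[p d] [s e]]. Qed.

Definition canonical M (v : tree 'I_M) (a : structure) (k : int) : Prop :=
  [/\ vssdd v a k, compressed v a k & trimmed a k].

(** What a canonical decomposition provides, phrased by elements instead of list positions:
    [prime_cover], [prime_inj] and [prime_sat] are the clauses of a partition, and [sub_uniq] is
    compression. *)
Record decomposition M (v : tree 'I_M) (l : seq element) (k : int)
    (xl xr : tree 'I_M) : Prop := Decomposition {
  prime_canonical : forall q, List.In q l -> canonical v q.1.1 (q.1.2 + k);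
  sub_canonical : forall q, List.In q l -> canonical v q.2.1 (q.2.2 + k);
  prime_below : forall q, List.In q l -> placed_below v q.1.1 (q.1.2 + k) xl;
  sub_below : forall q, List.In q l -> placed_below v q.2.1 (q.2.2 + k) xr;
  prime_cover : forall a, exists2 q, List.In q l & prime_of v k q a;
  prime_inj : forall q q' a, List.In q l -> List.In q' l ->
    prime_of v k q a -> prime_of v k q' a -> q = q';
  prime_sat : forall q, List.In q l -> exists a, prime_of v k q a;
  sub_uniq : uniq (sub_sems v k l) }.

(** Primes lie below the left child and subs below the right one, so every literal reached reads a
    leaf of [x]. *)
Lemma vssdd_supported M (v : tree 'I_M) a k x :
  vssdd v a k -> placed_below v a k x -> supported (eval v a k) (leaves x).
Proof.
move=> ak; elim: ak x => {a k} [k|k|k i E|k i E|t l k xl xr E _ _ IHp _ IHs Bp Bs _] x //.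
- case=> // -[z]; rewrite E => -[<-] /leaves_nodes zx a a' aa' /=.
  by rewrite E aa' // zx ?inE.
- case=> // -[z]; rewrite E => -[<-] /leaves_nodes zx a a' aa' /=.
  by rewrite E aa' // zx ?inE.
case=> // -[z]; rewrite E => -[<-] /leaves_nodes zx a a' aa'.
suff eqE q : List.In q l -> prime_of v k q a && sub_of v k q a = prime_of v k q a' && sub_of v k q a'.
  rewrite !eval_Dec; apply/In_hasP/In_hasP => -[q ql qa]; exists q => //.
    by rewrite -eqE.
  by rewrite eqE.
case: q => -[p d] [s e] ql; congr (_ && _).
  apply: (IHp _ _ _ _ ql _ (Bp _ _ _ _ ql)) => i il.
  by apply: aa'; rewrite zx //= mem_cat il.
apply: (IHs _ _ _ _ ql _ (Bs _ _ _ _ ql)) => i il.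
by apply: aa'; rewrite zx //= mem_cat il orbT.
Qed.

Lemma canonical_Dec M (v : tree 'I_M) t (l : seq element) k :
  canonical v (Dec t l) k ->
  exists xl xr, [/\ ID_inv v k = Some (Node xl xr),
    t = tree_shape (Node xl xr) & decomposition v l k xl xr].
Proof.
case=> sdd cmp trm; inversion sdd as [| | | |t' l' k' xl xr E Et Cp Cs Bp Bs [dis cov nf]].
subst t' l' k'; exists xl, xr; split=> //; split.
- move=> [[p d] [s e]] ql; split; first exact: Cp ql.
    by move=> t1 l1 j /(appears_prime t ql)/cmp.
  by move=> b j /(appears_prime t ql)/trm.
- move=> [[p d] [s e]] ql; split; first exact: Cs ql.
    by move=> t1 l1 j /(appears_sub t ql)/cmp.
  by move=> b j /(appears_sub t ql)/trm.
- by move=> [[p d] [s e]]; apply: Bp.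
- by move=> [[p d] [s e]]; apply: Bs.
- move=> a; have := cov a; rewrite has_map => /In_hasP[q ql /=].
  by rewrite ffunE => qa; exists q.
- move=> q q' a /(In_nthP q)[i lt_i qE] /(In_nthP q)[j lt_j qE'] qa q'a.
  case: (eqVneq i j) => [ij|/eqP ne_ij]; first by rewrite -qE -qE' ij.
  have := dis i j; rewrite /prime_sems size_map => /(_ lt_i lt_j ne_ij a).
  rewrite !(nth_map q) // qE qE' !ffunE.
  by rewrite /prime_of in qa q'a; rewrite qa q'a.
- move=> q ql; have [/existsP[a qa]|/existsPn qF] := boolP [exists a, prime_of v k q a].
    by exists a.
  case/negP: nf; rewrite -has_pred1 has_map; apply/In_hasP; exists q => //=.
  by apply/eqP/ffunP => a; rewrite !ffunE; apply/negbTE/qF.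
- exact: (cmp t l k (appears_refl _ _)).
Qed.

Lemma sub_inj M (v : tree 'I_M) l k xl xr q q' :
  decomposition v l k xl xr -> List.In q l -> List.In q' l ->
  sub_of v k q =1 sub_of v k q' -> q = q'.
Proof.
move=> D ql q'l qq'; apply: (uniq_map_In_inj (sub_uniq D)) => //.
by apply/ffunP => a; rewrite !ffunE; apply: qq'.
Qed.

Lemma eval_prime M (v : tree 'I_M) t l k xl xr q a :
  decomposition v l k xl xr -> List.In q l -> prime_of v k q a ->
  eval v (Dec t l) k a = sub_of v k q a.
Proof.
move=> D ql qa; rewrite eval_Dec; apply/In_hasP/idP => [[q' q'l /andP[q'a]]|sa].
  by rewrite (prime_inj D q'l ql q'a qa).
by exists q; rewrite ?qa.
Qed.

Lemma prime_supported M (v : tree 'I_M) l k xl xr q :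
  decomposition v l k xl xr -> List.In q l -> supported (prime_of v k q) (leaves xl).
Proof.
move=> D ql; have [sdd _ _] := prime_canonical D ql.
exact: vssdd_supported sdd (prime_below D ql).
Qed.

Lemma sub_supported M (v : tree 'I_M) l k xl xr q :
  decomposition v l k xl xr -> List.In q l -> supported (sub_of v k q) (leaves xr).
Proof.
move=> D ql; have [sdd _ _] := sub_canonical D ql.
exact: vssdd_supported sdd (sub_below D ql).
Qed.

(** The subs are the cofactors of the function: freezing the left variables where a prime holds
    leaves the sub of that prime. *)
Lemma eval_mix M (v : tree 'I_M) t l k xl xr q a c :
  uniq (leaves (Node xl xr)) -> decomposition v l k xl xr ->
  List.In q l -> prime_of v k q a ->
  eval v (Dec t l) k (mix (leaves xl) a c) = sub_of v k q c.
Proof.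
move=> ux D ql qa; rewrite (@eval_prime _ v t l k xl xr q) //.
  apply: (sub_supported D ql) => i ir; rewrite ffunE; case: ifP => // il.
  by case: (disjoint_children ux il ir).
rewrite -(prime_supported D ql (a := a)) // => i il.
by rewrite ffunE il.
Qed.

(** * Essential dependence and canonicity *)

(** For a function supported by the leaves of [z], this makes [z] the deepest vtree node containing
    its essential variables. *)
Definition essential M (F : assignment M -> bool) (z : tree 'I_M) : Prop :=
  ~ supported F [::] /\
  forall zl zr, z = Node zl zr ->
    ~ supported F (leaves zl) /\ ~ supported F (leaves zr).

(** One half of the simultaneous induction, quantified over all nodes of shape [t] so that the
    induction can run on [t]. *)
Definition essential_below M (v : tree 'I_M) (t : tree unit) : Prop :=
  forall x a k z, x \in nodes v -> tree_shape x = t ->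
    canonical v a k -> ~~ is_const a -> ID_inv v k = Some z -> z \in nodes x ->
    essential (eval v a k) z.

(* The bit [b] treats [f = g] and [f = ~ g] at once, so that [negate] never has
   to be shown to preserve compression and trimming. *)
Definition canonicity_below M (v : tree 'I_M) (t : tree unit) : Prop :=
  forall x y a a' k k' (s : 'S_M) b,
    x \in nodes v -> y \in nodes v -> tree_shape x = t -> tree_shape y = t ->
    renames s x y -> canonical v a k -> canonical v a' k' ->
    placed_below v a k x -> placed_below v a' k' y ->
    (forall c, eval v a k c = b (+) eval v a' k' (pullback s c)) ->
    same_structure a (xor_structure b a') /\
    (is_const a \/ k' = k + (ID v y - ID v x)).

Lemma constant_is_const M (v x : tree 'I_M) a k :
  essential_below v (tree_shape x) -> x \in nodes v -> canonical v a k ->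
  placed_below v a k x -> supported (eval v a k) [::] -> is_const a.
Proof.
move=> ess xv ca [//|[z E zx]] a0; apply/negPn/negP => na.
by case: (ess x a k z xv erefl ca na E zx) => /(_ a0).
Qed.

(** The case of the identity renaming. With [b] false and both structures equal it yields
    reflexivity of [same_structure]; with [b] true it recognizes a complement as a [negate]. *)
Lemma canonicity_same_place M (v x : tree 'I_M) a a' k k' b :
  canonicity_below v (tree_shape x) -> x \in nodes v ->
  canonical v a k -> canonical v a' k' ->
  placed_below v a k x -> placed_below v a' k' x ->
  (forall c, eval v a k c = b (+) eval v a' k' c) ->
  same_structure a (xor_structure b a') /\ (is_const a \/ k' = k).
Proof.
move=> can xv ca ca' pa pa' aa'.
have ren : renames 1%g x x.
  by move=> i j /corresponding_refl[->]; rewrite perm1.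
have E c : eval v a k c = b (+) eval v a' k' (pullback 1%g c).
  rewrite aa'; congr (_ (+) eval _ _ _ _); apply/ffunP => i.
  by rewrite ffunE perm1.
have := can x x a a' k k' 1%g b xv xv erefl erefl ren ca ca' pa pa' E.
by rewrite subrr addr0.
Qed.

(** A single prime must hold everywhere, so [essential_below] makes it a constant, necessarily
    [Top]. *)
Lemma singleton_trimmable M (v : tree 'I_M) t q k xl xr :
  xl \in nodes v -> xr \in nodes v ->
  essential_below v (tree_shape xl) -> canonicity_below v (tree_shape xr) ->
  decomposition v [:: q] k xl xr -> trimmable (Dec t [:: q]).
Proof.
move=> xlv xrv ess can D; have q_in : List.In q [:: q] by left.
have pT a : prime_of v k q a by have [q' [->|[]]] := prime_cover D a.
have pC : is_const q.1.1.
  apply: constant_is_const ess xlv (prime_canonical D q_in) (prime_below D q_in) _.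
  by move=> a a' _; move: (pT a) (pT a'); rewrite /prime_of => -> ->.
have [ss _] := canonicity_same_place (b := false) can xrv
  (sub_canonical D q_in) (sub_canonical D q_in)
  (sub_below D q_in) (sub_below D q_in) (fun=> erefl).
have {pC} p_Top : q.1.1 = Top.
  by have := pT [ffun => true]; rewrite /prime_of; case: q.1.1 pC.
exists t, q.2.1, q.2.2; left.
by rewrite same_structure_Dec eqxx /same_element /= p_Top ss eqxx !orbT.
Qed.

Lemma essential_Dec M (v : tree 'I_M) t l k xl xr :
  uniq (leaves v) -> Node xl xr \in nodes v ->
  essential_below v (tree_shape xl) -> essential_below v (tree_shape xr) ->
  canonicity_below v (tree_shape xl) -> canonicity_below v (tree_shape xr) ->
  trimmed (Dec t l) k -> decomposition v l k xl xr ->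
  ~ supported (eval v (Dec t l) k) (leaves xl) /\
  ~ supported (eval v (Dec t l) k) (leaves xr).
Proof.
move=> uv xv essl essr canl canr /(_ _ _ (appears_refl _ _)) trm D.
have [xlv xrv] := nodes_child xv; have ux := uniq_leaves_nodes uv xv.
have l_neq0 : l <> [::].
  by move=> l0; have [q] := prime_cover D [ffun => true]; rewrite l0.
split=> sup; last first.
  (* A function of the right variables alone equals each of its cofactors, so all subs coincide and
     compression leaves a single element. *)
  have subE q q' : List.In q l -> List.In q' l -> sub_of v k q =1 sub_of v k q'.
    move=> ql q'l c; have [[a qa] [a' qa']] := (prime_sat D ql, prime_sat D q'l).
    rewrite -(eval_mix t c ux D ql qa) -(eval_mix t c ux D q'l qa').
    apply: sup => i ir; rewrite !ffunE; case: ifP => // il.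
    by case: (disjoint_children ux il ir).
  case: l D l_neq0 trm subE {sup} => [|q [|q' l]] // D _ trm subE.
    exact/trm/(singleton_trimmable t xlv xrv essl canr D).
  have := sub_uniq D; rewrite /= inE negb_or => /andP[/andP[/eqP[]]].
  by apply/ffunP => a; rewrite !ffunE; apply: subE => /=; auto.
(* A function of the left variables alone has constant cofactors, so every sub is [Top] or [Bot]. *)
have subC q : List.In q l -> q.2.1 = Top \/ q.2.1 = Bot.
  move=> ql; have [a qa] := prime_sat D ql.
  have : is_const q.2.1.
    apply: constant_is_const essr xrv (sub_canonical D ql) (sub_below D ql) _.
    move=> c c' _; rewrite -!/(sub_of v k q _).
    rewrite -(eval_mix t c ux D ql qa) -(eval_mix t c' ux D ql qa).
    by apply: sup => i il; rewrite !ffunE il.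
  by case: q.2.1 => // _; [left | right].
have semC (q : element) (c : bool) : q.2.1 = (if c then Top else Bot) ->
    sem v q.2.1 (q.2.2 + k) = bconst M c.
  by move=> ->; apply/ffunP => a; rewrite !ffunE; case: c.
have {}subC q : List.In q l -> exists c : bool, q.2.1 = if c then Top else Bot.
  by case/subC=> ->; [exists true | exists false].
case: l D l_neq0 trm subC {sup} => [|q [|q' l]] // D _ trm subC.
  exact/trm/(singleton_trimmable t xlv xrv essl canr D).
have [c cE] : exists c : bool, q.2.1 = if c then Top else Bot.
  by apply: subC; left.
have [c' cE'] : exists c : bool, q'.2.1 = if c then Top else Bot.
  by apply: subC; right; left.
have := sub_uniq D; rewrite /= (semC _ _ cE) (semC _ _ cE') inE negb_or.
have bconst_neq (b b' : bool) : bconst M b != bconst M b' -> b' = ~~ b.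
  by case: b b' => [] [] // /eqP[].
case/andP=> /andP[/bconst_neq c'E _] _.
(* Subs are distinct and only two constants are available, so there is no third element. *)
have l0 : l = [::].
  case: l D trm subC => // q2 l D _ subC.
  have [c2 c2E] : exists c : bool, q2.2.1 = if c then Top else Bot.
    by apply: subC; right; right; left.
  have := sub_uniq D; rewrite /= (semC _ _ cE) (semC _ _ cE') (semC _ _ c2E).
  rewrite !inE !negb_or => /and3P[/and3P[_ /bconst_neq]].
  by rewrite c'E => -> _ /andP[/bconst_neq]; case: (c).
subst l c'; have q_in : List.In q [:: q; q'] by left.
have q'_in : List.In q' [:: q; q'] by right; left.
(* Some prime holds at [a]; were both to hold, the two elements would coincide although their subs
   are opposite constants. *)
have neg a : prime_of v k q a = true (+) prime_of v k q' a.
  have [q2 [<-|[<-|[]]] qa] := prime_cover D a; rewrite qa /=.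
    case E : (prime_of v k q' a) => //; have qq' := prime_inj D q_in q'_in qa E.
    by move: cE'; rewrite -qq' cE; case: (c).
  case E : (prime_of v k q a) => //; have qq' := prime_inj D q_in q'_in E qa.
  by move: cE'; rewrite -qq' cE; case: (c).
have neg' a : prime_of v k q' a = true (+) prime_of v k q a by rewrite neg addbA.
have Cq := prime_canonical D q_in; have Cq' := prime_canonical D q'_in.
have Bq := prime_below D q_in; have Bq' := prime_below D q'_in.
have [qq _] := canonicity_same_place (b := false) canl xlv Cq Cq Bq Bq (fun=> erefl).
have [qq' _] := canonicity_same_place (b := false) canl xlv Cq' Cq' Bq' Bq' (fun=> erefl).
have [nq dq] := canonicity_same_place (b := true) canl xlv Cq Cq' Bq Bq' neg.
have [nq' dq'] := canonicity_same_place (b := true) canl xlv Cq' Cq Bq' Bq neg'.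
(* The prime whose sub is [Top] plays the role of [b] in the excluded form. The other is its
   negation at the same offset, unless it is a constant, whose offset is ignored. *)
apply: trm; case: (c) cE cE' => /= cE cE'.
  exists t, q.1.1, q.1.2; right; rewrite same_structure_Dec eqxx /same_element /=.
  rewrite cE cE' qq nq' eqxx !orbT /=.
  by case: dq' => [->|/addIr->]; rewrite ?eqxx ?orbT.
exists t, q'.1.1, q'.1.2; right; rewrite same_structure_Dec eqxx /same_element /=.
rewrite cE cE' qq' nq eqxx !orbT /=.
by case: dq => [->|/addIr->]; rewrite ?eqxx ?orbT.
Qed.

(** * Matching the elements of two decompositions *)

Lemma pullback_mix M (s : 'S_M) (x y : tree 'I_M) a c :
  tree_shape x = tree_shape y -> renames s x y ->
  pullback s (mix (leaves x) a c) = mix (leaves y) (pullback s a) (pullback s c).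
Proof.
by move=> sh sxy; apply/ffunP => i; rewrite !ffunE (renames_leaves _ sh sxy).
Qed.

(** Freezing the left variables at [a] and at its pullback turns both sides into cofactors, which
    are the subs of the primes that hold there. *)
Lemma matching_subs M (v : tree 'I_M) t t' l l' k k' xl xr yl yr (s : 'S_M) b q q' a :
  uniq (leaves (Node xl xr)) -> uniq (leaves (Node yl yr)) ->
  tree_shape xl = tree_shape yl -> renames s xl yl ->
  decomposition v l k xl xr -> decomposition v l' k' yl yr ->
  (forall c, eval v (Dec t l) k c = b (+) eval v (Dec t' l') k' (pullback s c)) ->
  List.In q l -> List.In q' l' ->
  prime_of v k q a -> prime_of v k' q' (pullback s a) ->
  forall c, sub_of v k q c = b (+) sub_of v k' q' (pullback s c).
Proof.
move=> ux uy sh sxy D D' FF ql q'l qa q'a c.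
rewrite -(eval_mix t c ux D ql qa) FF (pullback_mix _ _ sh sxy).
by rewrite (eval_mix t' _ uy D' q'l q'a).
Qed.

(* By compression, the sub of an element determines its prime. *)
Lemma matching_primes M (v : tree 'I_M) t t' l l' k k' xl xr yl yr (s : 'S_M) b q q' a :
  uniq (leaves (Node xl xr)) -> uniq (leaves (Node yl yr)) ->
  tree_shape xl = tree_shape yl -> renames s xl yl ->
  decomposition v l k xl xr -> decomposition v l' k' yl yr ->
  (forall c, eval v (Dec t l) k c = b (+) eval v (Dec t' l') k' (pullback s c)) ->
  List.In q l -> List.In q' l' ->
  prime_of v k q a -> prime_of v k' q' (pullback s a) ->
  forall c, prime_of v k q c = prime_of v k' q' (pullback s c).
Proof.
move=> ux uy sh sxy D D' FF ql q'l qa q'a c.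
have subs := matching_subs ux uy sh sxy D D' FF.
have qq' := subs _ _ _ ql q'l qa q'a.
apply/idP/idP => [qc|q'c].
  have [q2 q2l q2c] := prime_cover D' (pullback s c).
  rewrite (sub_inj D' q'l q2l) // => e; apply: (can_inj (addKb b)).
  by rewrite -(pullbackK s e) -qq' (subs _ _ _ ql q2l qc q2c).
have [q2 q2l q2c] := prime_cover D c.
rewrite (sub_inj D ql q2l) // => e.
by rewrite qq' (subs _ _ _ q2l q'l q2c q'c).
Qed.

(** The gap between the IDs of a node and its right child depends only on the size of the left
    subtree, which isomorphic subtrees share. *)
Lemma ID_children_shift M (v xl xr yl yr : tree 'I_M) :
  uniq (leaves v) -> Node xl xr \in nodes v -> Node yl yr \in nodes v ->
  tree_shape xl = tree_shape yl ->
  ID v yl - ID v xl = ID v (Node yl yr) - ID v (Node xl xr) /\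
  ID v yr - ID v xr = ID v (Node yl yr) - ID v (Node xl xr).
Proof.
move=> uv xv yv sh; have [-> ->] := ID_children uv xv.
have [-> ->] := ID_children uv yv; rewrite (size_nodes_shape sh).
by split; rewrite ?(opprD _ (size _)%:Z) ?(addrACA _ (size _)%:Z) ?subrr ?addr0 opprD addrACA subrr addr0.
Qed.

(** Elements are paired when their primes hold at a common assignment, up to the renaming. Their
    primes and subs then agree as functions, up to [b] for the subs, and canonicity at the children
    makes them agree as structures. *)
Lemma same_Dec M (v : tree 'I_M) l l' k k' xl xr yl yr (s : 'S_M) b :
  uniq (leaves v) -> Node xl xr \in nodes v -> Node yl yr \in nodes v ->
  tree_shape (Node xl xr) = tree_shape (Node yl yr) ->
  renames s (Node xl xr) (Node yl yr) ->
  canonicity_below v (tree_shape xl) -> canonicity_below v (tree_shape xr) ->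
  ID_inv v k = Some (Node xl xr) -> ID_inv v k' = Some (Node yl yr) ->
  decomposition v l k xl xr -> decomposition v l' k' yl yr ->
  let t := tree_shape (Node xl xr) in
  (forall c, eval v (Dec t l) k c = b (+) eval v (Dec t l') k' (pullback s c)) ->
  same_structure (Dec t l) (xor_structure b (Dec t l')).
Proof.
move=> uv xv yv sh sxy canl canr Ek Ek' D D' t FF.
have [[xlv xrv] [ylv yrv]] := (nodes_child xv, nodes_child yv).
have [ux uy] := (uniq_leaves_nodes uv xv, uniq_leaves_nodes uv yv).
have [shl shr] : tree_shape xl = tree_shape yl /\ tree_shape xr = tree_shape yr.
  by case: sh.
have [sl sr] := renames_children sxy.
have [IDl IDr] := ID_children_shift uv xv yv shl.
have kE : k' = k + (ID v (Node yl yr) - ID v (Node xl xr)).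
  by rewrite (ID_invK uv Ek) (ID_invK uv Ek') addrC subrK.
have same q q' a : List.In q l -> List.In q' l' ->
    prime_of v k q a -> prime_of v k' q' (pullback s a) ->
    same_element q (xor_element b q').
  move=> ql q'l qa q'a.
  have subs := matching_subs ux uy shl sl D D' FF ql q'l qa q'a.
  have primes := matching_primes ux uy shl sl D D' FF ql q'l qa q'a.
  have [ps pd] := canl xl yl _ _ _ _ s false xlv ylv erefl (esym shl) sl
    (prime_canonical D ql) (prime_canonical D' q'l)
    (prime_below D ql) (prime_below D' q'l) primes.
  have [ss sd] := canr xr yr _ _ _ _ s b xrv yrv erefl (esym shr) sr
    (sub_canonical D ql) (sub_canonical D' q'l)
    (sub_below D ql) (sub_below D' q'l) subs.
  rewrite /same_element /= ps ss /=; apply/andP; split.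
    (* The shift between the children equals the shift between [k] and [k'], so the relative offsets
       agree. *)
    case: pd => [->//|]; rewrite IDl -addrA -kE => /addIr->.
    by rewrite eqxx orbT.
  case: sd => [->//|]; rewrite IDr -addrA -kE => /addIr->.
  by rewrite eqxx orbT.
rewrite xor_structure_Dec same_structure_Dec eqxx all_map /=.
(* Each prime holds somewhere, and the primes on the other side cover that assignment. *)
apply/andP; split; apply/In_allP => q ql; apply/In_hasP.
  have [a qa] := prime_sat D ql; have [q' q'l q'a] := prime_cover D' (pullback s a).
  exists (xor_element b q'); last exact: same q'a.
  by elim: l' q'l {D' FF same} => //= q2 l' IHl [->|/IHl]; [left | right].
have [a' qa] := prime_sat D' ql; rewrite -(pullbackK s a') in qa.
have [q' q'l q'a] := prime_cover D (pullback s^-1 a').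
by exists q' => //; apply: same qa.
Qed.

(** * The simultaneous induction on the vtree shape *)

(** Which child, if any, supports the function tells the three positions of [z] apart. This test is
    semantic, so a renaming preserves it. *)
Lemma essential_node_position M (v xl xr z : tree 'I_M) a k :
  uniq (leaves (Node xl xr)) -> vssdd v a k -> ID_inv v k = Some z ->
  essential (eval v a k) z -> z \in nodes (Node xl xr) ->
  [\/ [/\ z = Node xl xr, ~ supported (eval v a k) (leaves xl)
        & ~ supported (eval v a k) (leaves xr)],
      [/\ z \in nodes xl, supported (eval v a k) (leaves xl)
        & ~ supported (eval v a k) (leaves xr)]
    | [/\ z \in nodes xr, ~ supported (eval v a k) (leaves xl)
        & supported (eval v a k) (leaves xr)]].
Proof.
move=> ux ak E [nc ess]; rewrite /= inE mem_cat.
have disj := supported_disjoint (fun i => @disjoint_children _ xl xr i ux).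
case/or3P=> [/eqP zE|zl|zr].
- by constructor 1; have [] := ess _ _ zE.
- have sl : supported (eval v a k) (leaves xl).
    by apply: vssdd_supported ak _; right; exists z.
  by constructor 2; split=> // sr; apply/nc/disj.
- have sr : supported (eval v a k) (leaves xr).
    by apply: vssdd_supported ak _; right; exists z.
  by constructor 3; split=> // sl; apply/nc/disj.
Qed.

Lemma supported_literal M (i : 'I_M) b :
  ~ supported (fun c : assignment M => b (+) c i) [::].
Proof.
move=> sup; suff : b (+) true = b (+) false by case: b {sup}.
by have := sup [ffun => true] [ffun => false]; rewrite !ffunE; apply.
Qed.

(** Essential dependence makes one structure constant as soon as the other is, and a single
    assignment then decides which constant. *)
Lemma constant_canonicity M (v x y : tree 'I_M) a a' k k' (s : 'S_M) b t :
  essential_below v t -> tree_shape x = t -> tree_shape y = t ->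
  x \in nodes v -> y \in nodes v -> canonical v a k -> canonical v a' k' ->
  placed_below v a k x -> placed_below v a' k' y ->
  (forall c, eval v a k c = b (+) eval v a' k' (pullback s c)) ->
  is_const a \/ is_const a' -> is_const a /\ same_structure a (xor_structure b a').
Proof.
move=> ess shx shy xv yv ca ca' pa pa' FF cst.
have [essx essy] : essential_below v (tree_shape x) /\ essential_below v (tree_shape y).
  by rewrite shx shy.
have const0 a0 k0 : is_const a0 -> supported (eval v a0 k0) [::] by case: a0.
have a_const : is_const a.
  case: cst => // /const0-/(_ k') G0.
  apply: constant_is_const essx xv ca pa _ => c c' _.
  by rewrite !FF; congr (_ (+) _); apply: G0.
have a'_const : is_const a'.
  apply: constant_is_const essy yv ca' pa' (constant_pullback FF _).
  exact: const0.
split=> //; move: (FF [ffun => true]) a_const a'_const.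
by case: a {FF ca pa cst} => //; case: a' {ca' pa'} => //; case: b.
Qed.

Lemma canonical_at_Node M (v xl xr : tree 'I_M) a k :
  canonical v a k -> ~~ is_const a -> ID_inv v k = Some (Node xl xr) ->
  exists2 l, a = Dec (tree_shape (Node xl xr)) l & decomposition v l k xl xr.
Proof.
case: a => // [||t l] ca _ E; try by case: ca => sdd; inversion sdd; congruence.
have [xl' [xr' [E' -> D]]] := canonical_Dec ca.
by exists l; move: E' D; rewrite E => -[-> ->].
Qed.

Lemma essential_canonicity M (v : tree 'I_M) t :
  uniq (leaves v) -> essential_below v t /\ canonicity_below v t.
Proof.
move=> uv; elim: t => [[]|tl [essl canl] tr [essr canr]].
  (* Below a leaf a nonconstant structure is a literal; the bit [b] records its sign. *)
  have literal x a k : tree_shape x = Leaf tt -> canonical v a k ->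
      placed_below v a k x -> ~~ is_const a ->
      exists i b, [/\ x = Leaf i, ID_inv v k = Some x,
        a = (if b then Neg else Pos) & eval v a k =1 (fun c => b (+) c i)].
    case: x => [i _|//] [sdd _ _] [-> //|[z E]]; rewrite inE => /eqP zE.
    subst z; case: sdd E => // {a k} [k j _ E _|k j _ E _|? ? k ? ? -> //].
      by exists i, false; split=> // c /=; rewrite E.
    by exists i, true; split=> // c /=; rewrite E.
  have ess : essential_below v (Leaf tt).
    move=> x a k z xv sh ca na E zx.
    have [|i [b [xE _ _ F]]] := literal x a k sh ca _ na; first by right; exists z.
    subst x; move: zx; rewrite inE => /eqP->; split=> // F0.
    by apply: (@supported_literal _ i b) => c c' cc'; rewrite -!F; apply: F0.
  split=> // x y a a' k k' s b xv yv shx shy sxy ca ca' pa pa' FF.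
  have [acst|na] := boolP (is_const a).
    have [cst same] := constant_canonicity ess shx shy xv yv ca ca' pa pa' FF (or_introl acst).
    by split=> //; left.
  have [a'cst|na'] := boolP (is_const a').
    have [cst] := constant_canonicity ess shx shy xv yv ca ca' pa pa' FF (or_intror a'cst).
    by rewrite (negbTE na) in cst.
  have [i [e [xE Ek aE F]]] := literal x a k shx ca pa na.
  have [j [e' [yE Ek' aE' G]]] := literal y a' k' shy ca' pa' na'.
  split; last first.
    by right; rewrite (ID_invK uv Ek) (ID_invK uv Ek') addrC subrK.
  have sji : s j = i by apply: sxy; rewrite xE yE inE.
  (* At the all-false assignment each literal evaluates to its sign, so the signs differ by [b]. *)
  have := FF [ffun => false]; rewrite F G !ffunE aE aE'.
  by case: (e) (e') b {FF} => [] [] [].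
(* Essential dependence at this shape comes first, since canonicity uses it to locate the two
   structures. *)
have ess : essential_below v (Node tl tr).
  move=> x a k z xv; case: x xv => // xl xr xv [shl shr] ca na E.
  subst tl tr; have [xlv xrv] := nodes_child xv.
  rewrite /= inE mem_cat => /or3P[/eqP zE|zl|zr]; last 2 first.
  - exact: essl xlv erefl ca na E zl.
  - exact: essr xrv erefl ca na E zr.
  subst z; have [l aE D] := canonical_at_Node ca na E.
  subst a; set t := tree_shape _ in ca na *.
  have [nl nr] : ~ supported (eval v (Dec t l) k) (leaves xl) /\
      ~ supported (eval v (Dec t l) k) (leaves xr).
    by apply: essential_Dec D => //; case: ca.
  split; first by move=> F0; apply/nl/(supported_sub _ F0).
  by move=> _ _ [<- <-].
split=> // x y a a' k k' s b xv yv shx shy sxy ca ca' pa pa' FF.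
have [acst|na] := boolP (is_const a).
  have [cst same] := constant_canonicity ess shx shy xv yv ca ca' pa pa' FF (or_introl acst).
  by split=> //; left.
have [a'cst|na'] := boolP (is_const a').
  have [cst] := constant_canonicity ess shx shy xv yv ca ca' pa pa' FF (or_intror a'cst).
  by rewrite (negbTE na) in cst.
case: pa => [|[z E zx]]; first by rewrite (negbTE na).
case: pa' => [|[z' E' zy]]; first by rewrite (negbTE na').
have Fz := ess x a k z xv shx ca na E zx.
have Gz := ess y a' k' z' yv shy ca' na' E' zy.
case: x y xv yv shx shy sxy zx zy => // xl xr [] // yl yr xv yv.
move=> [shl shr] [shl' shr'] sxy zx zy; subst tl tr.
have [[xlv xrv] [ylv yrv]] := (nodes_child xv, nodes_child yv).
have [sl sr] := renames_children sxy.
have [IDl IDr] := ID_children_shift uv xv yv (esym shl').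
have suppl := supported_pullback (esym shl') sl FF.
have suppr := supported_pullback (esym shr') sr FF.
have [sdd _ _] := ca; have [sdd' _ _] := ca'.
(* Support transfers by [suppl] and [suppr], so mixed positions are contradictory: both nodes are
   the roots, or both lie on the left, or both on the right. *)
have := essential_node_position (uniq_leaves_nodes uv yv) sdd' E' Gz zy.
case: (essential_node_position (uniq_leaves_nodes uv xv) sdd E Fz zx) => -[zE Fl Fr] [] [zE' Gl Gr];
  try tauto.
- subst z z'; have [l aE D] := canonical_at_Node ca na E.
  have [l' aE' D'] := canonical_at_Node ca' na' E'.
  rewrite /= shl' shr' in aE'; subst a a'; split; last first.
    by right; rewrite (ID_invK uv E) (ID_invK uv E') addrC subrK.
  by apply: same_Dec D D' FF => //=; rewrite shl' shr'.
(* The left subtrees are shifted by the same amount as their parents, so the induction hypothesis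
   there suffices; likewise on the right. *)
- rewrite -IDl -(negbTE na); apply: (canl _ _ _ _ _ _ s b xlv ylv erefl shl' sl ca ca' _ _ FF); right;
    [by exists z | by exists z'].
- rewrite -IDr -(negbTE na); apply: (canr _ _ _ _ _ _ s b xrv yrv erefl shr' sr ca ca' _ _ FF); right;
    [by exists z | by exists z'].
Qed.

(** * From essential dependence on a vtree node to placement below it *)

Lemma nonconstant_supported M (f : boolfun M) :
  (forall b, f <> bconst M b) -> ~ supported f [::].
Proof.
move=> nf f0; apply: (nf (f [ffun => true])); apply/ffunP => a.
by rewrite !ffunE; apply: f0.
Qed.

(** The node [z] at offset [k] shares a leaf with [u], since the leaves of each support a
    nonconstant function, so one lies below the other. If [u] lay strictly below [z], a child of [z]
    would support the function, against essential dependence. *)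
Lemma canonical_placed_below M (v u : tree 'I_M) (f : boolfun M) a k :
  uniq (leaves v) -> canonical v a k -> eval v a k =1 f ->
  depends_on_node v f u -> ~~ is_const a /\ placed_below v a k u.
Proof.
move=> uv ca fE [/nonconstant_supported nf uv' /covers_supported fu _].
have F0 : ~ supported (eval v a k) [::].
  by move=> F0; apply: nf => c c' cc'; rewrite -!fE; apply: F0.
have Fu : supported (eval v a k) (leaves u).
  by move=> c c' cc'; rewrite !fE; apply: fu.
have na : ~~ is_const a by apply/negP => ac; apply: F0; case: a ac {ca fE Fu}.
split=> //; have [sdd _ _] := ca.
have [z E] : exists z, ID_inv v k = Some z.
  by case: sdd na => // *; eexists; eassumption.
have zv := ID_inv_nodes E.
(* Every node lies below the root, so the shape of [v] itself covers the unknown position of [z]. *)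
have [essv _] := essential_canonicity (tree_shape v) uv.
have [_ Fz] := essv v a k z (nodes_self v) erefl ca na E zv.
have {}sdd : supported (eval v a k) (leaves z).
  by apply: vssdd_supported sdd _; right; exists z => //; apply: nodes_self.
have [/hasP[i iu iz]|/hasPn dis] := boolP (has (mem (leaves z)) (leaves u)); last first.
  by case: F0; apply: supported_disjoint Fu sdd => i /dis/= /negbTE->.
right; exists z => //; have [uz|//] := nodes_comparable uv uv' zv iu iz.
case: z uz Fz {E zv sdd iz} => [j|zl zr]; first by rewrite /= inE => /eqP->; rewrite inE.
rewrite /= inE mem_cat => /or3P[/eqP-> _|uz|uz] /=; first by rewrite mem_head.
  by case/(_ _ _ erefl)=> [[]]; apply: supported_sub (leaves_nodes uz) Fu.
by case/(_ _ _ erefl)=> [_ []]; apply: supported_sub (leaves_nodes uz) Fu.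
Qed.

Theorem theorem2 (M : nat) (v u w : tree 'I_M) (s : 'S_M) (f g : boolfun M)
    (alpha beta : structure) (k l : int) :
  is_vtree v ->
  u \in nodes v -> w \in nodes v -> isomorphic u w ->
  (forall i j : 'I_M, (Leaf i, Leaf j) \in corresponding u w -> s j = i) ->
  depends_on_node v f u ->
  depends_on_node v g w ->
  substitution_equivalent s f g ->
  vssdd v alpha k -> compressed v alpha k -> trimmed alpha k ->
  sem v alpha k = f ->
  vssdd v beta l -> compressed v beta l -> trimmed beta l ->
  sem v beta l = g ->
  same_structure alpha beta /\ l = k + (ID v w - ID v u).
Proof.
move=> [uv _] uv' wv iso suw fu gw fg sa ca ta fE sb cb tb gE.
have fE' : eval v alpha k =1 f by move=> c; rewrite -fE ffunE.
have gE' : eval v beta l =1 g by move=> c; rewrite -gE ffunE.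
have Ca : canonical v alpha k by [].
have Cb : canonical v beta l by [].
have [na pa] := canonical_placed_below uv Ca fE' fu.
have [_ pb] := canonical_placed_below uv Cb gE' gw.
have [_ can] := essential_canonicity (tree_shape u) uv.
have FG c : eval v alpha k c = false (+) eval v beta l (pullback s c).
  by rewrite fE' gE' fg.
(* Since [alpha] is not a constant, its offset is determined. *)
have [same []] := can u w _ _ _ _ s false uv' wv erefl (esym iso) suw Ca Cb pa pb FG.
  by rewrite (negbTE na).
by [].
Qed.
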